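(* Let $\mathcal{D}=\{x_1,\dots,x_N\}$ and a query $q$ be given, with points indexed so that $p_1\ge p_2\ge\dots\ge p_N$ where $p_i=p(x_i,q)$, let $v\in\{1,\dots,N-1\}$ with $0<p_{v+1}<p_v$, and set $\Delta=p_{v+1}/p_v$. Let $K$ be a nonnegative integer and $B=\sum_{i=v+1}^N\sqrt{p_i^K/p_{v+1}^K}$ (computed with this $K$), and suppose $$K=\left\lceil 2\frac{\log B}{\log\frac1\Delta}\right\rceil.$$ Then $p_v^K\ge\sum_{i=v+1}^N p_i^K$, and the vectors $\mathbf{s}(q)$, $\tilde{\mathbf{s}}(q)$ with entries $s_i(q)=p_i^K$, $\tilde s_i(q)=\sqrt{p_i^K}$ satisfy $\|\mathbf{s}(q)\|_1\le v+1$ and $\|\tilde{\mathbf{s}}(q)\|_1\le v+1$.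
   Context: $p(x,q)\in[0,1]$ denotes the collision probability $\Pr_l[l(x)=l(q)]$ of an LSH family (a distribution over hash functions $l$ on the data space); using $K$ concatenated independent hashes gives collision probability $p(x,q)^K$. $\Delta$ measures the stability of the $v$-nearest-neighbor query and $B$ the sparsity of the vector of collision probabilities. *)

(* Defs.v *)
From HB Require Import structures.
From mathcomp Require Import all_boot all_order all_algebra.
From mathcomp Require Import all_classical all_reals all_analysis.

Set Implicit Arguments.
Unset Strict Implicit.
Unset Printing Implicit Defensive.

Import Order.TTheory GRing.Theory Num.Theory.

Local Open Scope classical_set_scope.
Local Open Scope ring_scope.

(* A distribution over hash functions [X -> lsh_bucket] is encoded as a random
   hash function on a probability space; the only measurability required is
   that of the collision events. *)
Record lsh_family (R : realType) (X : Type) := LshFamily {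
  lsh_display : measure_display;
  lsh_space : measurableType lsh_display;
  lsh_prob : probability lsh_space R;
  lsh_bucket : Type;
  lsh_hash : lsh_space -> X -> lsh_bucket;
  lsh_measurable : forall x y : X,
    measurable [set w : lsh_space | lsh_hash w x = lsh_hash w y]
}.

Definition collision_prob (R : realType) (X : Type) (L : lsh_family R X)
    (x q : X) : R :=
  fine (lsh_prob L [set w : lsh_space L | lsh_hash w x = lsh_hash w q]).

(* In the next two definitions [p] is indexed from 1: only [p 1], ..., [p N]
   are meaningful. *)
Definition stability (R : realType) (p : nat -> R) (v : nat) : R :=
  p v.+1 / p v.

Definition sparsity (R : realType) (p : nat -> R) (v N K : nat) : R :=
  \sum_(v.+1 <= i < N.+1) Num.sqrt (p i ^+ K / p v.+1 ^+ K).

(* The norm the library puts on row vectors is the sup norm. *)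
Definition l1norm (R : realType) (n : nat) (u : 'rV[R]_n) : R :=
  \sum_(i < n) `|u ord0 i|.

(* Coordinate [i : 'I_N] of these vectors is the entry of index [i.+1]. *)
Definition s_vec (R : realType) (p : nat -> R) (N K : nat) : 'rV[R]_N :=
  \row_(i < N) p i.+1 ^+ K.

Definition s_tilde_vec (R : realType) (p : nat -> R) (N K : nat) : 'rV[R]_N :=
  \row_(i < N) Num.sqrt (p i.+1 ^+ K).

(* Main.v *)
Require Import Defs.
From HB Require Import structures.
From mathcomp Require Import all_boot all_order all_algebra.
From mathcomp Require Import all_classical all_reals all_analysis.

Import Order.TTheory GRing.Theory Num.Theory.

Local Open Scope ring_scope.

(* Since B >= 1, the choice of K gives p_(v+1)^K B^2 <= p_v^K. The ratios
   b_i = sqrt (p_i^K / p_(v+1)^K) lie in [0, 1] and sum to B, so the sum of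
   the tail p_i^K is p_(v+1)^K * sum b_i^2 <= p_(v+1)^K B^2, and the sum of the
   tail sqrt (p_i^K) is sqrt (p_(v+1)^K B^2); both are at most 1. *)

Lemma collision_prob_ge0_le1 (R : realType) (X : Type) (L : lsh_family R X)
    (x q : X) : 0 <= collision_prob L x q <= 1.
Proof.
rewrite /collision_prob fine_ge0 ?measure_ge0 //=.
(* Measurability of the collision event makes its probability finite and at most 1, so [fine]
   returns the true value. *)
have mE := lsh_measurable L x q.
rewrite -lee_fin fineK ?probability_le1 //.
by apply: fin_num_measure.
Qed.

(** Each of the first [v] entries is at most 1, so they contribute at most [v]; the remaining
    entries contribute at most 1. Used with [f i] equal to $p_i^K$ and to its square root. *)
Lemma l1norm_le_head_tail (R : realType) (N v : nat) (f : nat -> R) :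
  (v <= N)%N ->
  (forall i, (1 <= i <= N)%N -> 0 <= f i <= 1) ->
  \sum_(v.+1 <= i < N.+1) f i <= 1 ->
  l1norm (\row_(i < N) f i.+1) <= v%:R + 1.
Proof.
move=> vN f01 tail1.
have -> : l1norm (\row_(i < N) f i.+1) = \sum_(1 <= i < N.+1) f i.
  rewrite big_add1 big_mkord /l1norm; apply: eq_bigr => i _.
  rewrite mxE ger0_norm //.
  by have /andP[] : 0 <= f i.+1 <= 1 by apply: f01; rewrite ltn_ord.
rewrite (@big_cat_nat _ _ _ v.+1) //=; apply: lerD => //.
apply: (@le_trans _ _ (\sum_(1 <= i < v.+1) 1)).
  rewrite !big_nat; apply: ler_sum => i /andP[i1 iv].
  have /andP[] : 0 <= f i <= 1.
    by apply: f01; rewrite i1 (leq_trans _ vN).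
  by [].
by rewrite big_const_nat iter_addr_0 subn1.
Qed.

(** After taking logarithms the claim reads [2 * ln B <= K * ln D]. Since [ln D > 0], it can be
    divided by [ln D], and a ceiling is at least its argument. *)
Lemma sqr_le_expr_of_ceil_ln (R : realType) (B D : R) (K : nat) :
  1 <= B -> 1 < D ->
  K%:Z = Num.ceil (2 * (ln B / ln D)) -> B ^+ 2 <= D ^+ K.
Proof.
move=> B1 D1 hK.
have B0 : 0 < B by apply: lt_le_trans B1.
have D0 : 0 < D by apply: lt_trans D1.
have lD0 : 0 < ln D by apply: ln_gt0.
rewrite -ler_ln ?posrE ?exprn_gt0 // !lnXn //.
rewrite -[ln B *+ 2]mulr_natl -[ln D *+ K]mulr_natl -ler_pdivrMr // -mulrA.
by apply: le_trans (ceil_ge _) _; rewrite -hK.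
Qed.

Theorem theorem5 (R : realType) (X : Type) (L : lsh_family R X)
    (N : nat) (x : nat -> X) (q : X) (p : nat -> R)
    (hp : forall i : nat, (1 <= i <= N)%N -> p i = collision_prob L (x i) q)
    (hsorted : forall i j : nat, (1 <= i)%N -> (i <= j)%N -> (j <= N)%N ->
      p j <= p i)
    (v : nat) (hv : (1 <= v <= N - 1)%N)
    (hpv1_gt0 : 0 < p v.+1) (hpv1_lt : p v.+1 < p v)
    (Delta : R) (hDelta : Delta = stability p v)
    (K : nat) (B : R) (hB : B = sparsity p v N K)
    (hK : K%:Z = Num.ceil (2 * (ln B / ln (1 / Delta)))) :
  [/\ \sum_(v.+1 <= i < N.+1) p i ^+ K <= p v ^+ K,
      l1norm (s_vec p N K) <= v%:R + 1 &
      l1norm (s_tilde_vec p N K) <= v%:R + 1].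
Proof.
move: hv => /andP[v1 vN1].
have vN : (v < N)%N.
  (* Subtraction on [nat] is truncated: [N = 0] would give [v <= 0], against [1 <= v]. *)
  by rewrite subn1 in vN1; case: (N) vN1 => [|n //]; rewrite leqNgt v1.
have p01 i : (1 <= i <= N)%N -> 0 <= p i <= 1.
  by move=> iN; rewrite hp // collision_prob_ge0_le1.
have pK01 i : (1 <= i <= N)%N -> 0 <= p i ^+ K <= 1.
  by move=> /p01/andP[p0 p1]; rewrite exprn_ge0 //= exprn_ile1.
set P := p v.+1 ^+ K.
have P0 : 0 < P by apply: exprn_gt0.
pose b i := Num.sqrt (p i ^+ K / P).
have BE : B = \sum_(v.+1 <= i < N.+1) b i by [].
have B1 : 1 <= B.
  (* The term of index [v.+1] is exactly 1, and the range contains it because [v < N]. *)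
  rewrite BE big_ltn // {1}/b divff ?gt_eqF // sqrtr1 lerDl.
  by apply: sumr_ge0 => i _; exact: sqrtr_ge0.
have pv0 : 0 < p v by apply: lt_trans hpv1_lt.
have D1 : 1 < 1 / Delta.
  by rewrite hDelta /stability div1r invf_div ltr_pdivlMr // mul1r.
have PB : P * B ^+ 2 <= p v ^+ K.
  have := sqr_le_expr_of_ceil_ln _ _ _ _ B1 D1 hK.
  rewrite hDelta /stability div1r invf_div expr_div_n ler_pdivlMr //.
  by rewrite mulrC.
have tail i : (v < i < N.+1)%N -> (1 <= i <= N)%N.
  by case/andP => vi iN; rewrite (leq_ltn_trans _ vi).
have sumK : \sum_(v.+1 <= i < N.+1) p i ^+ K <= p v ^+ K.
  (* The intermediate bound [P * B] is linear in the [b i], so the sums can be compared term by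
     term; [B <= B ^+ 2] because [1 <= B]. *)
  apply: le_trans PB; apply: (@le_trans _ _ (P * B)); last first.
    by rewrite ler_pM2l // expr2 ler_peMl // (le_trans _ B1).
  rewrite BE mulr_sumr !big_nat; apply: ler_sum => i iN.
  have /andP[pi0 _] := pK01 _ (tail _ iN).
  have t0 : 0 <= p i ^+ K / P by rewrite divr_ge0 // ltW.
  have pi_le : p i ^+ K / P <= 1.
    have /andP[p0 _] := p01 _ (tail _ iN).
    rewrite ler_pdivrMr // mul1r lerXn2r ?nnegrE ?(ltW hpv1_gt0) //.
    by case/andP: iN => vi iN; apply: hsorted.
  have b1 : b i <= 1 by rewrite -sqrtr1 ler_sqrt.
  (* Divided by [P], the goal becomes [b i ^+ 2 <= b i], true since [b i] lies in $[0,1]$. *)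
  rewrite -ler_pdivrMl // mulrC -[leLHS]sqr_sqrtr // expr2.
  by rewrite ler_piMl // sqrtr_ge0.
have /andP[_ pvK1] : 0 <= p v ^+ K <= 1 by apply: pK01; rewrite v1 ltnW.
split => //.
  apply: (l1norm_le_head_tail _ _ _ (fun i => p i ^+ K)) => //; first exact: ltnW.
  exact: le_trans pvK1.
apply: (l1norm_le_head_tail _ _ _ (fun i => Num.sqrt (p i ^+ K))).
- exact: ltnW.
- move=> i /pK01/andP[pi0 pi1].
  by rewrite sqrtr_ge0 -[leRHS]sqrtr1 ler_sqrt.
have -> : \sum_(v.+1 <= i < N.+1) Num.sqrt (p i ^+ K) = Num.sqrt P * B.
  rewrite BE mulr_sumr !big_nat; apply: eq_bigr => i iN.
  by rewrite -sqrtrM ?ltW // mulrC divfK ?gt_eqF.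
(* Writing [B] as the square root of [B ^+ 2] puts everything under one root, where [PB] applies. *)
rewrite -[B]ger0_norm ?(le_trans _ B1) // -sqrtr_sqr -sqrtrM ?(ltW P0) //.
by rewrite -[leRHS]sqrtr1 ler_sqrt //; apply: le_trans pvK1.
Qed.
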